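(* Let $A_1,\ldots,A_n$ be generic automorphisms of $\mathbb{P}^2(\mathbb{C})$. Then the subgroup $\langle A_1,\ldots,A_n,\sigma\rangle$ of $\mathrm{Bir}(\mathbb{P}^2(\mathbb{C}))$ generated by the $A_i$ and $\sigma$ is the free product $$\underbrace{\mathbb{Z}\ast\cdots\ast\mathbb{Z}}_{n}\ast(\mathbb{Z}/2\mathbb{Z})$$ (of the cyclic groups generated by $A_1,\ldots,A_n$ and $\sigma$). In particular the group generated by the quadratic transformations $A_1\sigma,\ldots,A_n\sigma$ is free.
   Context: $\mathrm{Bir}(\mathbb{P}^2(\mathbb{C}))$ is the group of birational maps of $\mathbb{P}^2(\mathbb{C})$ to itself and $\sigma=(x_1x_2:x_0x_2:x_0x_1)$ is the standard Cremona involution. ''Generic'' means that $(A_1,\ldots,A_n)\in\mathrm{PGL}_3(\mathbb{C})^n$ lies outside a suitable countable union of proper Zariski closed subsets of $\mathrm{PGL}_3(\mathbb{C})^n$. *)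

(* Defs.v *)
From HB Require Import structures.
From mathcomp Require Import all_boot all_order all_algebra generic_quotient.
From mathcomp Require Import boolp reals complex mpoly ring.

Set Implicit Arguments.
Unset Strict Implicit.
Unset Printing Implicit Defensive.

Import GRing.Theory.
Local Open Scope ring_scope.
Local Open Scope quotient_scope.

Section RationalMaps.
Context {K : fieldType}.
Local Notation triple := (3.-tuple {mpoly K[3]}).
Implicit Types (f g h : triple) (p : {mpoly K[3]}).

Definition nonzero_triple f : Prop := exists i, tnth f i != 0.

Definition is_ratmap f : Prop :=
  (exists d : nat, forall i, tnth f i \is d.-homog) /\ nonzero_triple f.

(* equality of (f_0 : f_1 : f_2) and (g_0 : g_1 : g_2) over K(x_0, x_1, x_2) *)
Definition same_map f g : bool :=
  [forall i, forall j, tnth f i * tnth g j == tnth f j * tnth g i].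

(* the formula for "f after g"; it defines a rational map exactly when the
   resulting triple is not identically zero *)
Definition comp_triple f g : triple := [tuple tnth f i \mPo g | i < 3].

Definition id_triple : triple := [tuple 'X_i | i < 3].

Definition inverse_maps f g : Prop :=
  [/\ nonzero_triple (comp_triple f g), same_map (comp_triple f g) id_triple,
      nonzero_triple (comp_triple g f) & same_map (comp_triple g f) id_triple].

Definition birational f : Prop :=
  is_ratmap f /\ exists g, is_ratmap g /\ inverse_maps f g.

Lemma same_mapP f g :
  reflect (forall i j, tnth f i * tnth g j = tnth f j * tnth g i)
          (same_map f g).
Proof.
apply: (iffP forallP) => [H i j|H i]; first by apply/eqP/(forallP (H i)).
by apply/forallP=> j; apply/eqP.
Qed.

Lemma same_map_refl : reflexive same_map.
Proof. by move=> f; apply/same_mapP=> i j; rewrite mulrC. Qed.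

Lemma same_map_sym : ssrbool.symmetric same_map.
Proof.
by move=> f g; apply/same_mapP/same_mapP=> H i j;
  rewrite mulrC -H mulrC.
Qed.

Lemma same_map_trans g f h :
  nonzero_triple g -> same_map f g -> same_map g h -> same_map f h.
Proof.
case=> k nz /same_mapP fg /same_mapP gh; apply/same_mapP=> i j.
apply: (mulfI nz).
by rewrite mulrCA gh mulrA fg -mulrA (gh i k) mulrCA.
Qed.

Lemma comp_mpoly_homog p f d e :
  p \is d.-homog -> (forall i, tnth f i \is e.-homog) ->
  p \mPo f \is (d * e).-homog.
Proof.
move=> /dhomogP hp hf; rewrite comp_mpolyEX big_seq.
apply: rpred_sum => m /hp /= <-; apply: rpredZ.
rewrite comp_mpolyX mdegE big_distrl /=.
apply: (big_ind2 (fun q c => q \is c.-homog)); first exact: dhomog1.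
  by move=> q c q' c'; apply: dhomogM.
by move=> i _; rewrite mulnC; apply: dhomogMn.
Qed.

Lemma comp_mpolyA p f g : (p \mPo f) \mPo g = p \mPo (comp_triple f g).
Proof.
rewrite [p \mPo f]comp_mpolyEX raddf_sum [RHS]comp_mpolyEX /=.
apply: eq_bigr => m _; rewrite comp_mpolyZ !comp_mpolyX rmorph_prod /=.
by congr (_ *: _); apply: eq_bigr => i _; rewrite rmorphXn /= tnth_mktuple.
Qed.

Lemma comp_tripleA f g h :
  comp_triple (comp_triple f g) h = comp_triple f (comp_triple g h).
Proof. by apply: eq_from_tnth => i; rewrite !tnth_mktuple comp_mpolyA. Qed.

Lemma comp_triple_idr f : comp_triple f id_triple = f.
Proof. by apply: eq_from_tnth => i; rewrite tnth_mktuple comp_mpoly_id. Qed.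

Lemma comp_triple_idl f : comp_triple id_triple f = f.
Proof.
by apply: eq_from_tnth => i; rewrite !tnth_mktuple comp_mpolyXU -tnth_nth.
Qed.

Lemma comp_mpoly_scale p f (q : {mpoly K[3]}) d : p \is d.-homog ->
  p \mPo [tuple q * tnth f i | i < 3] = q ^+ d * (p \mPo f).
Proof.
move=> /dhomogP hp; rewrite !comp_mpolyEX mulr_sumr !big_seq.
apply: eq_bigr => m /hp /= <-; rewrite !comp_mpolyX -scalerAr mdegE.
congr (_ *: _).
rewrite -prodrXr -big_split /=; apply: eq_bigr => i _.
by rewrite tnth_mktuple exprMn.
Qed.

Lemma comp_mpoly_same p f g d k : p \is d.-homog -> same_map f g ->
  tnth g k ^+ d * (p \mPo f) = tnth f k ^+ d * (p \mPo g).
Proof.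
move=> hp /same_mapP fg; rewrite -!comp_mpoly_scale //; congr (p \mPo _).
by apply: eq_from_tnth => i; rewrite !tnth_mktuple fg mulrC.
Qed.

Lemma comp_triple_homog f g :
  (exists d : nat, forall i, tnth f i \is d.-homog) ->
  (exists d : nat, forall i, tnth g i \is d.-homog) ->
  exists d : nat, forall i, tnth (comp_triple f g) i \is d.-homog.
Proof.
move=> [d hf] [e hg]; exists (d * e)%N => i.
by rewrite tnth_mktuple comp_mpoly_homog.
Qed.

(* a map with a right inverse is dominant, so composition with it is defined *)
Lemma comp_triple_ratmap f g h :
  is_ratmap f -> is_ratmap g -> nonzero_triple (comp_triple g h) ->
  same_map (comp_triple g h) id_triple -> is_ratmap (comp_triple f g).
Proof.
move=> [hf [i nzf]] [hg _] [k nz] sm.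
split; first exact: comp_triple_homog.
exists i; rewrite tnth_mktuple.
case: (hf) => d /(_ i) hp; apply: contra_neq nzf => p0.
have := comp_mpoly_same k hp sm.
rewrite -comp_mpolyA p0 comp_mpoly0 mulr0 comp_mpoly_id => /esym/eqP.
by rewrite mulf_eq0 expf_eq0 (negPf nz) andbF => /eqP.
Qed.

Lemma comp_triple_same f f' g g' :
  is_ratmap f' -> is_ratmap g' -> is_ratmap (comp_triple f' g) ->
  same_map f f' -> same_map g g' ->
  same_map (comp_triple f g) (comp_triple f' g').
Proof.
move=> [[d hf'] _] [_ [k nzg]] [_ nz] /same_mapP ff' gg'.
apply: (same_map_trans nz).
  by apply/same_mapP => i j; rewrite !tnth_mktuple -!rmorphM ff'.
apply/same_mapP => i j; rewrite !tnth_mktuple.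
have nzd : tnth g' k ^+ d != 0 by rewrite expf_neq0.
apply: (mulfI nzd); rewrite mulrA (comp_mpoly_same _ (hf' i) gg').
rewrite mulrA (comp_mpoly_same _ (hf' j) gg') -!mulrA; congr (_ * _).
exact: mulrC.
Qed.

Lemma id_ratmap : is_ratmap id_triple.
Proof.
split; first by exists 1%N => i; rewrite tnth_mktuple dhomogX /= mdeg1.
exists ord0; rewrite tnth_mktuple; apply/negP => /eqP/(congr1 (mcoeff U_(ord0))).
by rewrite mcoeffXU eqxx mcoeff0 => /eqP; rewrite oner_eq0.
Qed.

Lemma id_birational : birational id_triple.
Proof.
split; first exact: id_ratmap.
exists id_triple; split; first exact: id_ratmap.
by split; rewrite comp_triple_idr ?same_map_refl //; case: id_ratmap.
Qed.

Lemma inverse_maps_sym f g : inverse_maps f g -> inverse_maps g f.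
Proof. by case=> a b c d; split. Qed.

Lemma inverse_maps_comp f f' g g' :
  is_ratmap f -> is_ratmap f' -> is_ratmap g -> is_ratmap g' ->
  inverse_maps f f' -> inverse_maps g g' ->
  nonzero_triple (comp_triple (comp_triple f g) (comp_triple g' f')) /\
  same_map (comp_triple (comp_triple f g) (comp_triple g' f')) id_triple.
Proof.
move=> rf rf' rg rg' [n1 s1 n2 s2] [m1 t1 m2 t2].
have rgg' := comp_triple_ratmap rg rg' m2 t2.
have rgf' := comp_triple_ratmap rg' rf' n2 s2.
have rggf' := comp_triple_ratmap rgg' rf' n2 s2.
have rfg : is_ratmap (comp_triple f g) := comp_triple_ratmap rf rg m1 t1.
have ratif : is_ratmap (comp_triple id_triple f').
  by rewrite comp_triple_idl.
have sff : same_map (comp_triple (comp_triple g g') f') f'.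
  rewrite -[X in same_map _ X](comp_triple_idl f').
  by apply: comp_triple_same; rewrite ?same_map_refl //; exact: id_ratmap.
have rfgg : is_ratmap (comp_triple (comp_triple f g) g').
  exact: comp_triple_ratmap rfg rg' m2 t2.
have r : is_ratmap (comp_triple (comp_triple f g) (comp_triple g' f')).
  by rewrite -comp_tripleA; apply: comp_triple_ratmap n2 s2.
split; first by case: r.
have rff' := comp_triple_ratmap rf rf' n2 s2.
apply: same_map_trans n1 _ s1.
rewrite comp_tripleA -(comp_tripleA g).
apply: (comp_triple_same rf rf' _ (same_map_refl f) sff).
rewrite (comp_tripleA g) -comp_tripleA; exact: r.
Qed.

Lemma comp_birational f g :
  birational f -> birational g -> birational (comp_triple f g).
Proof.
move=> [rf [f' [rf' ff']]] [rg [g' [rg' gg']]].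
have [n1 s1 n2 s2] := ff'; have [m1 t1 m2 t2] := gg'.
split; first exact: comp_triple_ratmap m1 t1.
exists (comp_triple g' f'); split; first exact: comp_triple_ratmap n2 s2.
have [a b] := inverse_maps_comp rf rf' rg rg' ff' gg'.
have [c d] := inverse_maps_comp rg' rg rf' rf
  (inverse_maps_sym gg') (inverse_maps_sym ff').
by split.
Qed.

Lemma birational_comp_ratmap f g :
  is_ratmap f -> birational g -> is_ratmap (comp_triple f g).
Proof. by move=> rf [rg [h [_ [m1 t1 _ _]]]]; apply: comp_triple_ratmap m1 t1. Qed.

End RationalMaps.

Definition birep (K : fieldType) :=
  {f : 3.-tuple {mpoly K[3]} | `[< birational f >]}.

Section Bir.
Variable K : fieldType.
Local Notation birep := (birep K).
Implicit Types f g h : birep.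

Lemma birepP f : birational (val f).
Proof. by case: f => f /= /asboolP. Qed.

Lemma birep_ratmap f : is_ratmap (val f).
Proof. by case: (birepP f). Qed.

Definition birep_eq f g := same_map (val f) (val g).

Fact birep_eq_refl : reflexive birep_eq.
Proof. by move=> f; exact: same_map_refl. Qed.
Fact birep_eq_sym : ssrbool.symmetric birep_eq.
Proof. by move=> f g; exact: same_map_sym. Qed.
Fact birep_eq_trans : transitive birep_eq.
Proof. by move=> g f h; apply: same_map_trans; case: (birep_ratmap g). Qed.

Canonical birep_equiv :=
  EquivRel birep_eq birep_eq_refl birep_eq_sym birep_eq_trans.

Definition Bir := {eq_quot birep_equiv}.
HB.instance Definition _ := Choice.on Bir.
HB.instance Definition _ := EqQuotient.on Bir.

Definition bir_of (f : 3.-tuple {mpoly K[3]}) (bf : birational f) : Bir :=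
  \pi_Bir (Sub f (asboolT bf) : birep).

Definition birep_one : birep := Sub id_triple (asboolT id_birational).

Definition birep_mul f g : birep :=
  Sub (comp_triple (val f) (val g))
      (asboolT (comp_birational (birepP f) (birepP g))).

Fact birep_inv_ex f : exists g : birep, inverse_maps (val f) (val g).
Proof.
have [rf [g [rg fg]]] := birepP f.
have bg : birational g.
  exact: (conj rg (ex_intro _ (val f) (conj rf (inverse_maps_sym fg)))).
exists (Sub g (asboolT bg)); exact: fg.
Qed.

Definition birep_inv f : birep := sval (cid (birep_inv_ex f)).

Fact birep_invP f : inverse_maps (val f) (val (birep_inv f)).
Proof. exact: svalP (cid (birep_inv_ex f)). Qed.

(* the product is composition: (x * y) is "x after y" *)
Definition bir_one : Bir := \pi_Bir birep_one.
Definition bir_mul (x y : Bir) : Bir := \pi_Bir (birep_mul (repr x) (repr y)).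
Definition bir_inv (x : Bir) : Bir := \pi_Bir (birep_inv (repr x)).

Lemma birepE f g : birep_eq f g -> \pi_Bir f = \pi_Bir g.
Proof. by move=> H; apply/eqP; rewrite eqmodE. Qed.

Lemma eq_birep f g : val f = val g -> \pi_Bir f = \pi_Bir g.
Proof. by move/val_inj->. Qed.

Lemma repr_birep f : birep_eq (repr (\pi_Bir f)) f.
Proof. by rewrite -[birep_eq _ _]/(birep_equiv _ _) -eqmodE reprK. Qed.

Lemma bir_mulE f g : bir_mul (\pi_Bir f) (\pi_Bir g) = \pi_Bir (birep_mul f g).
Proof.
apply: birepE; apply: comp_triple_same; try exact: birep_ratmap.
- by apply: birational_comp_ratmap; [exact: birep_ratmap | exact: birepP].
- exact: repr_birep.
- exact: repr_birep.
Qed.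

Fact bir_mulA : associative bir_mul.
Proof.
elim/quotW=> f; elim/quotW=> g; elim/quotW=> h.
rewrite (bir_mulE g h) (bir_mulE f g) (bir_mulE f (birep_mul g h)).
rewrite (bir_mulE (birep_mul f g) h).
exact: (@eq_birep (birep_mul f (birep_mul g h)) (birep_mul (birep_mul f g) h)
  (esym (comp_tripleA (val f) (val g) (val h)))).
Qed.

Fact bir_mul1 : left_id bir_one bir_mul.
Proof.
elim/quotW=> f; rewrite bir_mulE.
exact: (@eq_birep (birep_mul birep_one f) f (comp_triple_idl (val f))).
Qed.

Fact bir_mulr1 : right_id bir_one bir_mul.
Proof.
elim/quotW=> f; rewrite bir_mulE.
exact: (@eq_birep (birep_mul f birep_one) f (comp_triple_idr (val f))).
Qed.

Fact bir_mulV : left_inverse bir_one bir_inv bir_mul.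
Proof.
move=> x; rewrite -{2}[x]reprK bir_mulE; apply: birepE.
by have [_ _ _ H] := birep_invP (repr x); exact: H.
Qed.

Fact bir_mulVr : right_inverse bir_one bir_inv bir_mul.
Proof.
move=> x; rewrite -{1}[x]reprK bir_mulE; apply: birepE.
by have [_ H _ _] := birep_invP (repr x); exact: H.
Qed.

HB.instance Definition _ :=
  isGroup.Build Bir bir_mulA bir_mul1 bir_mulr1 bir_mulV bir_mulVr.

End Bir.

Section Generators.
Variable K : fieldType.

Definition cremona_triple : 3.-tuple {mpoly K[3]} :=
  let x (i : 'I_3) : {mpoly K[3]} := 'X_i in
  [tuple x 1%R * x 2%R; x 0%R * x 2%R; x 0%R * x 1%R].

Lemma monomial_neq0 (m : 'X_{1..3}) : 'X_[m] != 0 :> {mpoly K[3]}.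
Proof.
apply/negP => /eqP/(congr1 (mcoeff m)); rewrite mcoeffX eqxx mcoeff0.
by move/eqP; rewrite oner_eq0.
Qed.

Lemma cremona_ratmap : is_ratmap cremona_triple.
Proof.
split; last first.
  by exists 0; rewrite (tnth_nth 0) /= -mpolyXD monomial_neq0.
exists 2%N; case; case=> [|[|[|//]]] lti; rewrite (tnth_nth 0) /=;
  by rewrite -mpolyXD dhomogX /= mdegD !mdeg1.
Qed.

Lemma comp_cremona : comp_triple cremona_triple cremona_triple =
  [tuple 'X_(0%R : 'I_3) * 'X_(1%R : 'I_3) * 'X_(2%R : 'I_3) * 'X_i | i < 3].
Proof.
apply: eq_from_tnth => i; rewrite !tnth_mktuple.
have E0 : 'X_(0%R : 'I_3) \mPo cremona_triple = 'X_(1%R : 'I_3) * 'X_(2%R : 'I_3).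
  by rewrite comp_mpolyXU.
have E1 : 'X_(1%R : 'I_3) \mPo cremona_triple = 'X_(0%R : 'I_3) * 'X_(2%R : 'I_3).
  by rewrite comp_mpolyXU.
have E2 : 'X_(2%R : 'I_3) \mPo cremona_triple = 'X_(0%R : 'I_3) * 'X_(1%R : 'I_3).
  by rewrite comp_mpolyXU.
case: i => [[|[|[|//]]] lti].
- rewrite (_ : Ordinal lti = 0%R); last exact: val_inj.
  by rewrite rmorphM /= E1 E2; ring.
- rewrite (_ : Ordinal lti = 1%R); last exact: val_inj.
  by rewrite rmorphM /= E0 E2; ring.
- rewrite (_ : Ordinal lti = 2%R); last exact: val_inj.
  by rewrite rmorphM /= E0 E1; ring.
Qed.

Lemma cremona_birational : birational cremona_triple.
Proof.
have H : nonzero_triple (comp_triple cremona_triple cremona_triple) /\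
         same_map (comp_triple cremona_triple cremona_triple) id_triple.
  rewrite comp_cremona; split.
    by exists 0; rewrite tnth_mktuple -!mpolyXD monomial_neq0.
  by apply/same_mapP => i j; rewrite !tnth_mktuple mulrAC.
case: H => nz sm; split; first exact: cremona_ratmap.
by exists cremona_triple; split; [exact: cremona_ratmap|split].
Qed.

Definition cremona : Bir K := bir_of cremona_birational.

(* x |-> M x on column vectors *)
Definition linear_triple (M : 'M[K]_3) : 3.-tuple {mpoly K[3]} :=
  [tuple \sum_j M i j *: 'X_j | i < 3].

Lemma comp_linear_triple (M N : 'M[K]_3) :
  comp_triple (linear_triple M) (linear_triple N) = linear_triple (M *m N).
Proof.
apply: eq_from_tnth => i; rewrite !tnth_mktuple raddf_sum /=.
under eq_bigr => j _.
  rewrite comp_mpolyZ comp_mpolyXU -tnth_nth tnth_mktuple scaler_sumr.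
  over.
rewrite exchange_big /=; apply: eq_bigr => k _; rewrite mxE scaler_suml.
by apply: eq_bigr => j _; rewrite scalerA.
Qed.

Lemma linear_triple1 : linear_triple 1%:M = id_triple.
Proof.
apply: eq_from_tnth => i; rewrite !tnth_mktuple (bigD1 i) //= big1 ?addr0.
  by rewrite mxE eqxx scale1r.
by move=> j /negPf nij; rewrite mxE eq_sym nij scale0r.
Qed.

Lemma linear_triple_ratmap (M : 'M[K]_3) :
  M \in unitmx -> is_ratmap (linear_triple M).
Proof.
move=> uM; split.
  exists 1%N => i; rewrite tnth_mktuple; apply: rpred_sum => j _.
  by apply: rpredZ; rewrite dhomogX /= mdeg1.
apply: contrapT => H.
have M0 : M = 0.
  apply/matrixP => i j; rewrite mxE; apply: contrapT => /eqP nz; apply: H.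
  exists i; rewrite tnth_mktuple.
  apply: contra_neq nz => /(congr1 (mcoeff U_(j))).
  rewrite mcoeff0 raddf_sum /= (bigD1 j) //= mcoeffZ mcoeffXU eqxx mulr1.
  rewrite big1 ?addr0 // => k /negPf nkj.
  by rewrite mcoeffZ mcoeffXU nkj mulr0.
by move: uM; rewrite M0 unitmxE det0 unitr0.
Qed.

Lemma linear_birational (M : 'M[K]_3) :
  M \in unitmx -> birational (linear_triple M).
Proof.
move=> uM; have uV : invmx M \in unitmx by rewrite unitmx_inv.
have [_ nz] := @id_ratmap K.
split; first exact: linear_triple_ratmap.
exists (linear_triple (invmx M)); split; first exact: linear_triple_ratmap.
rewrite /inverse_maps !comp_linear_triple mulmxV // mulVmx // linear_triple1.
by split=> //; exact: same_map_refl.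
Qed.

End Generators.

Definition GL3 (K : fieldType) := {M : 'M[K]_3 | M \in unitmx}.

Section PGL.
Variable K : fieldType.
Local Notation GL3 := (GL3 K).

Definition proportional (M N : GL3) : bool :=
  `[< exists2 c : K, c != 0 & val M = c *: val N >].

Fact proportional_refl : reflexive proportional.
Proof. by move=> M; apply/asboolP; exists 1; rewrite ?oner_neq0 ?scale1r. Qed.
Fact proportional_sym : ssrbool.symmetric proportional.
Proof.
have H M N : proportional M N -> proportional N M.
  move/asboolP => [c nz E]; apply/asboolP; exists c^-1; first by rewrite invr_eq0.
  by rewrite E scalerK.
by move=> M N; apply/idP/idP; apply: H.
Qed.
Fact proportional_trans : transitive proportional.
Proof.
move=> N M P /asboolP[c nzc Ec] /asboolP[d nzd Ed]; apply/asboolP.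
by exists (c * d); rewrite ?mulf_neq0 // Ec Ed scalerA.
Qed.

Canonical proportional_equiv := EquivRel proportional
  proportional_refl proportional_sym proportional_trans.

Definition PGL3 := {eq_quot proportional_equiv}.
HB.instance Definition _ := Choice.on PGL3.
HB.instance Definition _ := EqQuotient.on PGL3.

Definition pgl_class (M : GL3) : PGL3 := \pi_PGL3 M.

Definition pgl_bir (A : PGL3) : Bir K := bir_of (linear_birational (svalP (repr A))).

Lemma pgl_birE (M : GL3) :
  pgl_bir (pgl_class M) = bir_of (linear_birational (svalP M)).
Proof.
apply: birepE; apply/same_mapP => i j.
have /eqmodP/asboolP[c _ E] : repr (\pi_PGL3 M) = M %[mod PGL3] by rewrite reprK.
change (tnth (linear_triple (val (repr (\pi_PGL3 M)))) i * tnth (linear_triple (val M)) j =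
  tnth (linear_triple (val (repr (\pi_PGL3 M)))) j * tnth (linear_triple (val M)) i).
rewrite E.
have F k : tnth (linear_triple (c *: val M)) k = c *: tnth (linear_triple (val M)) k.
  rewrite !tnth_mktuple scaler_sumr.
  by apply: eq_bigr => l _; rewrite mxE scalerA.
by rewrite !F -!scalerAl mulrC.
Qed.

(* PGL_3^n carries the topology of a product of open subsets of P(M_3) = P^8:
   closed sets are cut out by polynomials in the 9n matrix entries which are
   homogeneous in the entries of each of the n matrices separately. *)

Definition entry_index (n : nat) : finType := ('I_n * 'I_3 * 'I_3)%type.

Definition entries n (M : 'I_n -> GL3) (k : 'I_#|entry_index n|) : K :=
  let: (i, r, c) := enum_val k in val (M i) r c.

Definition multihomogeneous n (p : {mpoly K[#|entry_index n|]}) : Prop :=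
  exists d : 'I_n -> nat, forall m, m \in msupp p -> forall i : 'I_n,
    (\sum_(r < 3) \sum_(c < 3) m (enum_rank ((i, r, c) : entry_index n)))%N
    = d i.

Definition zariski_closed n (Z : ('I_n -> PGL3) -> Prop) : Prop :=
  exists S : {mpoly K[#|entry_index n|]} -> Prop,
    (forall p, S p -> multihomogeneous p) /\
    forall M : 'I_n -> GL3,
      Z (fun i => pgl_class (M i)) <-> (forall p, S p -> p.@[entries M] = 0).

Definition holds_generically n (P : ('I_n -> PGL3) -> Prop) : Prop :=
  exists Z : nat -> ('I_n -> PGL3) -> Prop,
    (forall k, zariski_closed (Z k) /\ exists A, ~ Z k A) /\
    forall A, (forall k, ~ Z k A) -> P A.

End PGL.

(* {multiplicative G -> H} does not bundle f 1 = 1 *)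
Notation group_hom G H := (UMagmaMorphism.type G H).

Section FreeProduct.
Context {I : choiceType} (G : I -> groupType).
Definition fp_word := seq {i : I & G i}.
HB.instance Definition _ := Choice.on fp_word.
Implicit Types u v w : fp_word.

Definition fp_letter i (x : G i) : {i : I & G i} := Tagged G x.

(* the congruence on words identifying the letter 1 of each factor with the
   empty word and two adjacent letters of one factor with their product *)
Inductive fp_eq : fp_word -> fp_word -> Prop :=
| FpRefl u : fp_eq u u
| FpSym u v : fp_eq u v -> fp_eq v u
| FpTrans u v w : fp_eq u v -> fp_eq v w -> fp_eq u w
| FpOne u v i : fp_eq (u ++ fp_letter (1 : G i)%g :: v) (u ++ v)
| FpMul u v i (x y : G i) :
    fp_eq (u ++ [:: fp_letter x, fp_letter y & v])
          (u ++ fp_letter (x * y)%g :: v).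

Definition fp_eqb u v : bool := `[< fp_eq u v >].

Fact fp_eqb_refl : reflexive fp_eqb.
Proof. by move=> u; apply/asboolP; exact: FpRefl. Qed.
Fact fp_eqb_sym : ssrbool.symmetric fp_eqb.
Proof. by move=> u v; apply/asboolP/asboolP; exact: FpSym. Qed.
Fact fp_eqb_trans : transitive fp_eqb.
Proof.
by move=> v u w /asboolP uv /asboolP vw; apply/asboolP; exact: FpTrans uv vw.
Qed.

Canonical fp_equiv := EquivRel fp_eqb fp_eqb_refl fp_eqb_sym fp_eqb_trans.

Definition free_product := {eq_quot fp_equiv}.
HB.instance Definition _ := Choice.on free_product.
HB.instance Definition _ := EqQuotient.on free_product.

Definition fp_class u : free_product := \pi_free_product u.

Definition fp_inv_letter (a : {i : I & G i}) : {i : I & G i} :=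
  fp_letter (tagged a)^-1%g.
Definition fp_inv_word u : fp_word := rev (map fp_inv_letter u).

Lemma fp_classP u v : fp_class u = fp_class v <-> fp_eq u v.
Proof.
split=> [/eqP|H]; first by rewrite eqmodE => /asboolP.
by apply/eqP; rewrite eqmodE; apply/asboolP.
Qed.

Lemma fp_reprK u : fp_eq (repr (fp_class u)) u.
Proof. by apply/fp_classP; exact: reprK. Qed.

Lemma fp_eq_catl w u v : fp_eq u v -> fp_eq (w ++ u) (w ++ v).
Proof.
elim=> {u v} [u|u v _|u v z _ H _|u v i|u v i x y].
- exact: FpRefl.
- exact: FpSym.
- exact: FpTrans H.
- by rewrite !catA; exact: FpOne.
- by rewrite !catA; exact: FpMul.
Qed.

Lemma fp_eq_catr w u v : fp_eq u v -> fp_eq (u ++ w) (v ++ w).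
Proof.
elim=> {u v} [u|u v _|u v z _ H _|u v i|u v i x y].
- exact: FpRefl.
- exact: FpSym.
- exact: FpTrans H.
- by rewrite -!catA; exact: FpOne.
- by rewrite -!catA; exact: FpMul.
Qed.

Lemma fp_eq_cat u u' v v' : fp_eq u u' -> fp_eq v v' -> fp_eq (u ++ v) (u' ++ v').
Proof.
by move=> /(fp_eq_catr v) H /(fp_eq_catl u'); exact: FpTrans H.
Qed.

Definition fp_one : free_product := fp_class [::].
Definition fp_mul (x y : free_product) : free_product :=
  fp_class (repr x ++ repr y).
Definition fp_inv (x : free_product) : free_product :=
  fp_class (fp_inv_word (repr x)).

Lemma fp_mulE u v : fp_mul (fp_class u) (fp_class v) = fp_class (u ++ v).
Proof. by apply/fp_classP; apply: fp_eq_cat; exact: fp_reprK. Qed.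

Lemma fp_invVw u : fp_eq (fp_inv_word u ++ u) [::].
Proof.
elim: u => [|a u IHu]; first exact: FpRefl.
rewrite /fp_inv_word /= rev_cons -cats1 -catA /=.
apply: FpTrans IHu; case: a => i x.
apply: FpTrans (FpMul (fp_inv_word u) u x^-1%g x) _.
by rewrite mulVg; exact: FpOne.
Qed.

Lemma fp_invwV u : fp_eq (u ++ fp_inv_word u) [::].
Proof.
elim: u => [|a u IHu]; first exact: FpRefl.
rewrite /fp_inv_word /= rev_cons -cats1 catA.
apply: FpTrans (fp_eq_catl [:: a] (fp_eq_catr [:: fp_inv_letter a] IHu)) _.
case: a => i x /=.
apply: FpTrans (FpMul [::] [::] x x^-1%g) _.
by rewrite mulgV; exact: (FpOne [::] [::]).
Qed.

Fact fp_mulA : associative fp_mul.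
Proof.
elim/quotW=> u; elim/quotW=> v; elim/quotW=> w.
rewrite -[\pi u]/(fp_class u) -[\pi v]/(fp_class v) -[\pi w]/(fp_class w).
by rewrite !fp_mulE catA.
Qed.
Fact fp_mul1 : left_id fp_one fp_mul.
Proof. by elim/quotW=> u; exact: fp_mulE. Qed.
Fact fp_mulr1 : right_id fp_one fp_mul.
Proof.
by elim/quotW=> u; rewrite -[\pi u]/(fp_class u) fp_mulE cats0.
Qed.
Fact fp_mulV : left_inverse fp_one fp_inv fp_mul.
Proof.
move=> x; rewrite -{2}[x]reprK -[\pi _]/(fp_class _) fp_mulE.
by apply/fp_classP; exact: fp_invVw.
Qed.
Fact fp_mulVr : right_inverse fp_one fp_inv fp_mul.
Proof.
move=> x; rewrite -{1}[x]reprK -[\pi _]/(fp_class _) fp_mulE.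
by apply/fp_classP; exact: fp_invwV.
Qed.

HB.instance Definition _ :=
  isGroup.Build free_product fp_mulA fp_mul1 fp_mulr1 fp_mulV fp_mulVr.

Definition fp_inj i (x : G i) : free_product := fp_class [:: fp_letter x].

Lemma fp_injM i (x y : G i) : fp_inj (x * y)%g = (fp_inj x * fp_inj y)%g.
Proof.
rewrite -[RHS]/(fp_mul _ _) fp_mulE.
by apply/fp_classP/FpSym; exact: (FpMul [::] [::]).
Qed.

Lemma fp_class_prod u :
  fp_class u = (\prod_(a <- u) fp_inj (tagged a))%g.
Proof.
elim: u => [|[i x] u IHu]; first by rewrite big_nil.
by rewrite big_cons -IHu -[RHS]/(fp_mul _ _) fp_mulE.
Qed.

Theorem fp_universal (H : groupType) (f : forall i, group_hom (G i) H) :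
  exists2 phi : group_hom free_product H,
    (forall i (x : G i), phi (fp_inj x) = f i x)
  & forall psi : group_hom free_product H,
      (forall i (x : G i), psi (fp_inj x) = f i x) -> psi =1 phi.
Proof.
pose lw u : H := (\prod_(a <- u) f (tag a) (tagged a))%g.
have lw_eq u v : fp_eq u v -> lw u = lw v.
  elim=> {u v} [//|//|u v w _ -> //|u v i|u v i x y].
    by rewrite /lw !big_cat big_cons /= gmulf1 mul1g.
  by rewrite /lw !big_cat !big_cons /= gmulfM !mulgA.
pose l (x : free_product) : H := lw (repr x).
have lE u : l (fp_class u) = lw u by apply/lw_eq/fp_reprK.
have lM : {morph l : x y / (x * y)%g}.
  elim/quotW=> u; elim/quotW=> v.
  rewrite -[\pi u]/(fp_class u) -[\pi v]/(fp_class v).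
  by rewrite -[(_ * _)%g]/(fp_mul _ _) fp_mulE !lE /lw big_cat.
have l1 : l 1%g = 1%g by rewrite -[1%g]/(fp_class [::]) lE /lw big_nil.
pose phiM := isMultiplicative.Build free_product H l lM.
pose phi1 := Multiplicative_isUMagmaMorphism.Build free_product H l l1.
pose phi : group_hom free_product H := HB.pack l phiM phi1.
exists phi => [i x|psi Hpsi].
  by rewrite -[phi _]/(l _) lE /lw big_seq1.
elim/quotW=> u; rewrite -[\pi u]/(fp_class u) -[RHS]/(l _) lE /lw.
rewrite fp_class_prod gmulf_prod.
by apply: eq_bigr => a _; rewrite Hpsi.
Qed.

End FreeProduct.

(* the subgroup generated by X, as the intersection of the subgroups
   containing X *)
Definition generated (H : groupType) (X : H -> Prop) (h : H) : Prop :=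
  forall S : {pred H}, group_closed S -> (forall x, X x -> x \in S) -> h \in S.

Definition isom_onto (G H : groupType) (phi : group_hom G H)
    (S : H -> Prop) : Prop :=
  injective phi /\ forall h, S h <-> exists g, phi g = h.

(* the additive groups, viewed as (multiplicative) groupTypes *)
Definition Zgroup : groupType := Algebra.to_multiplicative int.
Definition Z2group : groupType := Algebra.to_multiplicative 'Z_2.

(* Z * ... * Z * (Z/2Z), with n copies of Z *)
Definition free_factor n (o : option 'I_n) : groupType :=
  if o is Some _ then Zgroup else Z2group.
Definition freeZ_Z2 n : groupType := free_product (@free_factor n).
Definition freeZ_Z2_gen n (i : 'I_n) : freeZ_Z2 n :=
  fp_inj (G := @free_factor n) (i := Some i) (1%R : int).
(* 1%R is the residue class 1; a bare 1 : 'Z_2 would be the group unit 0 *)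
Definition freeZ_Z2_inv n : freeZ_Z2 n :=
  fp_inj (G := @free_factor n) (i := None) (1%R : 'Z_2).

Definition free_group n : groupType := free_product (fun _ : 'I_n => Zgroup).
Definition free_gen n (i : 'I_n) : free_group n :=
  fp_inj (G := fun _ : 'I_n => Zgroup) (i := i) (1%R : int).

(* Main.v *)
From HB Require Import structures.
Require Import Defs.
From mathcomp Require Import all_boot all_order all_algebra generic_quotient.
From mathcomp Require Import perm boolp reals complex mpoly ring lra.
Set Implicit Arguments.
Unset Strict Implicit.
Unset Printing Implicit Defensive.
Import Order.TTheory GRing.Theory Num.Theory.
Local Open Scope ring_scope.
Local Open Scope quotient_scope.

(* For each nonempty reduced word w in the letters A_i, A_i^-1, sigma, the
   condition w(A) = 1 in Bir(P^2) is Zariski closed in A: it says that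
   x_j w(A)(x)_i = x_i w(A)(x)_j for all points x, where w(A)(x) is polynomial,
   multihomogeneous, in the entries of the A_i. There are countably many words,
   so it remains to see that each of these closed sets is proper. The line
   x_1 = x_2 is preserved by sigma, which acts on it as y |-> 1 / y; one takes
   for the A_i real matrices preserving this line and acting on it as Schottky
   generators whose 2n discs lie in 0 < y < 1 / 2, and plays ping-pong from the
   base point y = 3 / 4. *)

(** * Multivariate polynomials as functions *)

(** In characteristic zero the naturals below [size p] are distinct, and a nonzero [p] has fewer
    than [size p] roots. *)
Lemma poly_eq0_horner (F : numDomainType) (p : {poly F}) :
  (forall x, p.[x] = 0) -> p = 0.
Proof.
move=> p0; apply/eqP/negPn/negP => nzp.
have := max_poly_roots (rs := [seq k%:R | k <- iota 0 (size p)]) nzp.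
rewrite size_map size_iota ltnn => /(_ _ _)/negP; apply => //.
  by apply/allP => _ /mapP[k _ ->]; apply/rootP.
by rewrite map_inj_uniq ?iota_uniq // => k l /eqP; rewrite eqr_nat => /eqP.
Qed.

(** [muni] singles out the last variable, so a monomial splits into its exponent at [ord_max] and
    the exponents of the remaining variables. *)
Lemma mcoeff_muni n (F : comNzRingType) (p : {mpoly F[n.+1]}) (m : 'X_{1..n.+1}) :
  (muni p)`_(m ord_max)@_[multinom m (widen_ord (leqnSn n) i) | i < n] = p@_m.
Proof.
rewrite muniE [in RHS](mpolyE p) !raddf_sum /= coef_sum raddf_sum /=.
apply: eq_bigr => k _; rewrite coefZ coefXn mulr_natr mcoeffZ mcoeffX.
rewrite mcoeffMn mcoeffZ mcoeffX; case: (eqVneq k m) => [->|nkm].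
  by rewrite !eqxx.
rewrite mulr0; case: eqVneq => [/mnmP km|_]; last by rewrite mulr0 mul0rn.
case: eqVneq => [kmn|_]; last by rewrite mulr0n.
case/eqP: nkm; apply/mnmP => i.
case: (unliftP ord_max i) => [j ->|->] //.
have := km j; rewrite !mnmE.
rewrite (_ : lift _ _ = widen_ord (leqnSn n) j) //.
by apply: val_inj; rewrite /= /bump leqNgt ltn_ord.
Qed.

Lemma meval_muni n (F : comNzRingType) (p : {mpoly F[n.+1]}) (v : 'I_n.+1 -> F) :
  (map_poly (meval (fun i : 'I_n => v (widen_ord (leqnSn n) i))) (muni p)).[v ord_max]
  = p.@[v].
Proof.
rewrite muniE [in RHS]mevalE raddf_sum horner_sum; apply: eq_bigr => m _.
rewrite /= map_polyZ /= map_polyXn hornerZ hornerXn mevalZ mevalX -mulrA.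
by rewrite big_ord_recr /=; congr (_ * (_ * _)); apply: eq_bigr => i _; rewrite mnmE.
Qed.

(** Induction on the number of variables: with the first [n] fixed, the univariate polynomial in the
    last one vanishes everywhere, so each coefficient of [muni p] vanishes as a function. *)
Lemma mpoly_eq0_meval n (F : numDomainType) (p : {mpoly F[n]}) :
  (forall v, p.@[v] = 0) -> p = 0.
Proof.
elim: n p => [|n IHn] p p0.
  suff pE : p = (p@_0%MM)%:MP by have := p0 (fun=> 0); rewrite pE mevalC => ->.
  apply/mpolyP => m; rewrite (_ : m = 0%MM) ?mcoeffC ?eqxx ?mulr1 //.
  by apply/mnmP; case.
apply/mpolyP => m; rewrite mcoeff0 -mcoeff_muni.
suff -> : muni p = 0 by rewrite coef0 mcoeff0.
apply/polyP => k; rewrite coef0; apply: IHn => v.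
rewrite -coef_map /=; set q := map_poly _ _.
suff -> : q = 0 by rewrite coef0.
apply: poly_eq0_horner => x.
pose u (i : 'I_n.+1) := if unlift ord_max i is Some j then v j else x.
have <- : p.@[u] = 0 by [].
rewrite -meval_muni {2}/u unlift_none; congr (_.[_]).
apply: eq_map_poly => r; apply: meval_eq => i.
rewrite /u (_ : widen_ord _ _ = lift ord_max i) ?liftK //.
by apply: val_inj; rewrite /= /bump leqNgt ltn_ord.
Qed.

(** * Words in the generators *)

(* [None] stands for the involution, [Some (i, false)] for the i-th generator
   of infinite order and [Some (i, true)] for its inverse. *)
Notation letter n := (option ('I_n * bool)).

Definition letter_val n (G : groupType) (a : 'I_n -> G) (s : G) (l : letter n) : G :=
  match l with
  | None => s
  | Some (i, b) => if b then (a i)^-1%g else a i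
  end.

Definition word_val n (G : groupType) (a : 'I_n -> G) (s : G) (w : seq (letter n)) : G :=
  (\prod_(l <- w) letter_val a s l)%g.

Lemma word_val_nil n (G : groupType) (a : 'I_n -> G) (s : G) :
  word_val a s [::] = 1%g.
Proof. exact: big_nil. Qed.

Lemma word_val_cons n (G : groupType) (a : 'I_n -> G) (s : G) l w :
  word_val a s (l :: w) = (letter_val a s l * word_val a s w)%g.
Proof. exact: big_cons. Qed.

Lemma word_val_cat n (G : groupType) (a : 'I_n -> G) (s : G) u w :
  word_val a s (u ++ w) = (word_val a s u * word_val a s w)%g.
Proof. exact: big_cat. Qed.

(** Indices in ['I_3] add modulo 3, so each coordinate becomes the product of the other two. *)
Definition cremona_vec (R : comNzRingType) (v : 'cV[R]_3) : 'cV[R]_3 :=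
  \col_i (v (i + 1) 0 * v (i + 2%:R) 0).

(* The adjugate replaces the inverse: it is polynomial in the entries and
   defines the same element of PGL_3. *)
Definition letter_mx n (R : comNzRingType) (M : 'I_n -> 'M[R]_3) (a : 'I_n * bool) :
    'M[R]_3 :=
  if a.2 then \adj (M a.1) else M a.1.

Definition letter_act n (R : comNzRingType) (M : 'I_n -> 'M[R]_3) (l : letter n)
    (v : 'cV[R]_3) : 'cV[R]_3 :=
  if l is Some a then letter_mx M a *m v else cremona_vec v.

Definition word_act n (R : comNzRingType) (M : 'I_n -> 'M[R]_3) (w : seq (letter n))
    (v : 'cV[R]_3) : 'cV[R]_3 := foldr (letter_act M) v w.

(** All letters act by integer polynomials. This serves both to specialize indeterminate entries and
    to pass from real to complex matrices. *)
Lemma map_word_act n (R S : comNzRingType) (f : {rmorphism R -> S})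
    (M : 'I_n -> 'M[R]_3) (w : seq (letter n)) (v : 'cV[R]_3) :
  map_mx f (word_act M w v) = word_act (fun i => map_mx f (M i)) w (map_mx f v).
Proof.
elim: w => //= [[[i b]|]] w <- /=.
  by rewrite /letter_mx; case: b; rewrite map_mxM ?map_mx_adj.
by apply/colP => i; rewrite !mxE rmorphM.
Qed.

Section WordTriple.
Variables (n : nat) (K : fieldType).
Implicit Types (M : 'I_n -> 'M[K]_3) (w : seq (letter n)).

Definition letter_triple M (l : letter n) : 3.-tuple {mpoly K[3]} :=
  if l is Some a then linear_triple (letter_mx M a) else cremona_triple K.

Definition word_triple M w : 3.-tuple {mpoly K[3]} :=
  foldr (fun l => comp_triple (letter_triple M l)) (id_triple (K := K)) w.

Lemma letter_triple_meval M l (v : 'cV[K]_3) i :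
  (tnth (letter_triple M l) i).@[fun j => v j 0] = letter_act M l v i 0.
Proof.
case: l => [a|] /=.
  rewrite tnth_mktuple raddf_sum mxE /=; apply: eq_bigr => j _.
  by rewrite mevalZ mevalXU.
rewrite mxE (tnth_nth 0).
case: i => [[|[|[|//]]] lti]; rewrite /= mevalM !mevalXU; last first.
- by congr (v _ 0 * v _ 0); apply: val_inj.
- by rewrite mulrC; congr (v _ 0 * v _ 0); apply: val_inj.
- by congr (v _ 0 * v _ 0); apply: val_inj.
Qed.

Lemma word_triple_meval M w (v : 'cV[K]_3) i :
  (tnth (word_triple M w) i).@[fun j => v j 0] = word_act M w v i 0.
Proof.
elim: w i => [|l w IHw] i /=; first by rewrite tnth_mktuple mevalXU.
rewrite tnth_mktuple comp_mpoly_meval -letter_triple_meval.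
by apply: meval_eq => j; rewrite IHw.
Qed.

End WordTriple.

(** * Values of words in the group of birational maps *)

Section WordBir.
Variables (n : nat) (K : fieldType).
Implicit Types (w : seq (letter n)).

Lemma bir_ofM (f g : 3.-tuple {mpoly K[3]}) (bf : birational f) (bg : birational g) :
  (bir_of bf * bir_of bg)%g = bir_of (comp_birational bf bg).
Proof. by rewrite -[LHS]/(bir_mul _ _) bir_mulE; apply: eq_birep. Qed.

Lemma bir_of_same (f g : 3.-tuple {mpoly K[3]}) (bf : birational f) (bg : birational g) :
  bir_of bf = bir_of bg <-> same_map f g.
Proof.
split=> [/eqmodP //|fg]; exact: birepE.
Qed.

Lemma adj_unitmx (M : 'M[K]_3) : M \in unitmx -> \adj M \in unitmx.
Proof.
move=> uM; have /mulmx1_unit[] // : (\det M)^-1 *: M *m \adj M = 1%:M.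
by rewrite -scalemxAl mul_mx_adj -(scalemx1 _ (\det M)) scalerK // -unitfE -unitmxE.
Qed.

(** The product of [M] with its adjugate is a nonzero scalar matrix, which is the identity as a
    rational map. *)
Lemma pgl_birV (M : GL3 K) :
  (pgl_bir (pgl_class M))^-1%g = bir_of (linear_birational (adj_unitmx (svalP M))).
Proof.
apply: (mulgI (pgl_bir (pgl_class M))); rewrite mulgV pgl_birE bir_ofM.
apply/esym/bir_of_same; rewrite comp_linear_triple mul_mx_adj.
apply/same_mapP => i j; rewrite -scalemx1.
have E k : tnth (linear_triple (\det (sval M) *: 1%:M)) k = \det (sval M) *: 'X_k.
  have := congr1 (fun t => tnth t k) (linear_triple1 K); rewrite !tnth_mktuple => <-.
  by rewrite scaler_sumr; apply: eq_bigr => l _; rewrite mxE scalerA.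
by rewrite !E !tnth_mktuple -!scalerAl mulrC.
Qed.

Lemma letter_val_bir (M : 'I_n -> GL3 K) (l : letter n) :
  exists bf : birational (letter_triple (fun i => sval (M i)) l),
    letter_val (fun i => pgl_bir (pgl_class (M i))) (cremona K) l = bir_of bf.
Proof.
case: l => [[i []]|] /=.
- by exists (linear_birational (adj_unitmx (svalP (M i)))); rewrite pgl_birV.
- by exists (linear_birational (svalP (M i))); rewrite pgl_birE.
- by exists (cremona_birational K).
Qed.

Lemma word_val_bir (M : 'I_n -> GL3 K) w :
  exists bf : birational (word_triple (fun i => sval (M i)) w),
    word_val (fun i => pgl_bir (pgl_class (M i))) (cremona K) w = bir_of bf.
Proof.
elim: w => [|l w [bf IHw]] /=.
  by rewrite word_val_nil; exists id_birational.
have [bl El] := letter_val_bir M l.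
by exists (comp_birational bl bf); rewrite word_val_cons IHw El bir_ofM.
Qed.

End WordBir.

(** A polynomial identity in [x] may be tested at all points, which turns triviality of a word into
    equations in the matrix entries, one for each [v], [i], [j]. *)
Lemma word_val_bir1 n (K : numFieldType) (M : 'I_n -> GL3 K) (w : seq (letter n)) :
  word_val (fun i => pgl_bir (pgl_class (M i))) (cremona K) w = 1%g <->
  forall (v : 'cV[K]_3) i j,
    word_act (fun i => sval (M i)) w v i 0 * v j 0 =
    word_act (fun i => sval (M i)) w v j 0 * v i 0.
Proof.
have [bf ->] := word_val_bir M w; rewrite -[1%g]/(bir_of (@id_birational K)).
rewrite bir_of_same; split=> [/same_mapP fid v i j|H].
  have := congr1 (meval (fun j => v j 0)) (fid i j).
  by rewrite !mevalM !tnth_mktuple !mevalXU !word_triple_meval.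
apply/same_mapP => i j; apply/eqP; rewrite -subr_eq0; apply/eqP.
apply: mpoly_eq0_meval => u.
rewrite mevalB !mevalM !tnth_mktuple !mevalXU; apply/eqP; rewrite subr_eq0.
have := H (\col_k u k) i j; rewrite -!word_triple_meval !mxE => E.
have Eu k : (tnth (word_triple (fun i => sval (M i)) w) k).@[u] =
   (tnth (word_triple (fun i => sval (M i)) w) k).@[fun j => (\col_k u k) j 0].
  by apply: meval_eq => l; rewrite mxE.
by rewrite !Eu E.
Qed.

(** * Multihomogeneous polynomials *)

Section Multihomogeneity.
Variables (n : nat) (K : fieldType).
Local Notation entry_poly := {mpoly K[#|entry_index n|]}.
Implicit Types (p q : entry_poly) (d e : 'I_n -> nat) (m : 'X_{1..#|entry_index n|}).

Definition entry_rank (i : 'I_n) (r c : 'I_3) : 'I_#|entry_index n| :=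
  enum_rank ((i, r, c) : entry_index n).

Definition multideg m (i : 'I_n) : nat :=
  (\sum_(r < 3) \sum_(c < 3) m (entry_rank i r c))%N.

Definition multihom d p := forall m, m \in msupp p -> multideg m =1 d.

Lemma multidegD m1 m2 i : multideg (m1 + m2)%MM i = (multideg m1 i + multideg m2 i)%N.
Proof.
rewrite /multideg -big_split; apply: eq_bigr => r _; rewrite -big_split.
by apply: eq_bigr => c _; rewrite mnmDE.
Qed.

Lemma multihom_ext d e p : d =1 e -> multihom d p -> multihom e p.
Proof. by move=> de dp m /dp + i => ->. Qed.

Lemma multihomC c : multihom (fun=> 0%N) c%:MP.
Proof.
move=> m; rewrite msuppC; case: eqP => // _; rewrite inE => /eqP-> i.
by rewrite /multideg big1 // => r _; rewrite big1 // => k _; rewrite mnm0E.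
Qed.

Lemma multihom0 d : multihom d 0.
Proof. by move=> m; rewrite msupp0. Qed.

Lemma multihomD d p q : multihom d p -> multihom d q -> multihom d (p + q).
Proof. by move=> dp dq m /msuppD_le; rewrite mem_cat => /orP[/dp|/dq]. Qed.

Lemma multihomN d p : multihom d p -> multihom d (- p).
Proof. by move=> dp m; rewrite (perm_mem (msuppN p)) => /dp. Qed.

Lemma multihomM d e p q :
  multihom d p -> multihom e q -> multihom (fun i => (d i + e i)%N) (p * q).
Proof.
move=> dp eq m /msuppM_le/allpairsP[[m1 m2] [/= /dp d1 /eq e2 ->]] i.
by rewrite multidegD d1 e2.
Qed.

Lemma multihom_sum d (I : Type) (s : seq I) (P : pred I) (F : I -> entry_poly) :
  (forall k, P k -> multihom d (F k)) -> multihom d (\sum_(k <- s | P k) F k).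
Proof. by move=> dF; apply: big_ind dF; [exact: multihom0 | exact: multihomD]. Qed.

Lemma multihom_prod d (I : Type) (s : seq I) (F : I -> entry_poly) :
  (forall k, multihom d (F k)) ->
  multihom (fun i => (size s * d i)%N) (\prod_(k <- s) F k).
Proof.
move=> dF; elim: s => [|k s IHs]; first by rewrite big_nil; exact: multihomC.
by rewrite big_cons; apply: multihomM.
Qed.

Lemma multihomX i r c :
  multihom (fun j => (i == j) : nat) ('X_(entry_rank i r c) : entry_poly).
Proof.
move=> m; rewrite msuppX inE => /eqP-> j; rewrite /multideg.
rewrite pair_big /= (bigD1 (r, c)) //= big1 ?addn0.
  by rewrite mnm1E /entry_rank (inj_eq enum_rank_inj) !xpair_eqE !eqxx !andbT.
move=> [r' c']; rewrite xpair_eqE mnm1E /entry_rank (inj_eq enum_rank_inj) !xpair_eqE.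
by rewrite -andbA [r == r']eq_sym [c == c']eq_sym => /negPf->; rewrite andbF.
Qed.

Lemma multihom_sign d k p : multihom d p -> multihom d ((-1) ^+ k * p).
Proof. by rewrite -signr_odd mulr_sign => dp; case: odd => //; apply: multihomN. Qed.

Lemma multihom_det d k (A : 'M[entry_poly]_k) :
  (forall r c, multihom d (A r c)) -> multihom (fun i => (k * d i)%N) (\det A).
Proof.
move=> dA; apply: multihom_sum => s _; apply: multihom_sign.
have := multihom_prod (s := enum 'I_k) (fun r => dA r ((s : {perm _}) r)).
by rewrite size_enum_ord big_enum.
Qed.

(** Matrices of indeterminates: the word acts on them once, and [entries M] then specializes the
    result to any [M]. *)
Definition generic_mx (i : 'I_n) : 'M[entry_poly]_3 :=
  \matrix_(r, c) 'X_(entry_rank i r c).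

(** One multidegree is shared by all coordinates, so that sums and differences of their products
    stay multihomogeneous. *)
Definition vec_multihom (v : 'cV[entry_poly]_3) :=
  exists d, forall r, multihom d (v r 0).

Lemma mulmx_multihom (A : 'M[entry_poly]_3) d (v : 'cV[entry_poly]_3) :
  (forall r c, multihom d (A r c)) -> vec_multihom v -> vec_multihom (A *m v).
Proof.
move=> dA [e ev]; exists (fun i => (d i + e i)%N) => r; rewrite mxE.
by apply: multihom_sum => c _; apply: multihomM.
Qed.

Lemma letter_act_multihom (l : letter n) (v : 'cV[entry_poly]_3) :
  vec_multihom v -> vec_multihom (letter_act generic_mx l v).
Proof.
case: l => [[i b]|] /=; last first.
  by case=> d dv; exists (fun i => (d i + d i)%N) => r; rewrite mxE; apply: multihomM.
have hM r c : multihom (fun j => (i == j) : nat) (generic_mx i r c).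
  by rewrite mxE; apply: multihomX.
case: b => hv; last exact: mulmx_multihom hM hv.
(* Entries of the adjugate are signed 2 by 2 minors, of degree 2 in the [i]-th matrix and 0 in the
   others. *)
apply: (mulmx_multihom (d := fun j => (2 * (i == j))%N)) hv => r c.
rewrite /letter_mx /= !mxE; apply: multihom_sign.
by apply: (multihom_det (k := 2)) => r' c'; rewrite !mxE; apply: multihomX.
Qed.

Lemma word_act_multihom (w : seq (letter n)) (v : 'cV[K]_3) :
  vec_multihom (word_act generic_mx w (map_mx (@mpolyC _ K) v)).
Proof.
elim: w => [|l w IHw] /=; last exact: letter_act_multihom.
by exists (fun=> 0%N) => r; rewrite mxE; apply: multihomC.
Qed.

Lemma meval_word_act (M : 'I_n -> GL3 K) (w : seq (letter n)) (v : 'cV[K]_3) :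
  map_mx (meval (entries M)) (word_act generic_mx w (map_mx (@mpolyC _ K) v)) =
  word_act (fun i => sval (M i)) w v.
Proof.
rewrite map_word_act -map_mx_comp; congr (word_act _ w _).
  apply: funext => i; apply/matrixP => r c.
  by rewrite !mxE /= mevalXU /entries /entry_rank enum_rankK.
by apply/colP => r; rewrite !mxE /= mevalC.
Qed.

End Multihomogeneity.

(** The equations say that the image of each constant vector [v] is parallel to [v]; each one
    involves only the matrix entries. *)
Lemma word_val_closed n (K : numFieldType) (w : seq (letter n)) :
  zariski_closed (fun A : 'I_n -> PGL3 K =>
    word_val (fun i => pgl_bir (A i)) (cremona K) w = 1%g).
Proof.
pose V v := word_act (@generic_mx n K) w (map_mx (@mpolyC _ K) v).
exists (fun p => exists (v : 'cV[K]_3) i j,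
  p = V v i 0 * (v j 0)%:MP - V v j 0 * (v i 0)%:MP).
split=> [_ [v [i [j ->]]]|M].
  have [d dV] := word_act_multihom w v; exists d.
  suff H a b : multihom d (V v a 0 * (v b 0)%:MP).
    exact: multihomD (H _ _) (multihomN (H _ _)).
  have := multihomM (dV a) (@multihomC n K (v b 0)).
  by apply: multihom_ext => k; rewrite addn0.
have EV v i : (V v i 0).@[entries M] = word_act (fun i => sval (M i)) w v i 0.
  by rewrite -meval_word_act mxE.
rewrite word_val_bir1; split=> [H _ [v [i [j ->]]]|H v i j].
  by rewrite mevalB !mevalM !mevalC !EV H subrr.
apply/eqP; rewrite -subr_eq0 -!EV; apply/eqP.
rewrite -(mevalC (entries M) (v j 0)) -(mevalC (entries M) (v i 0)).
by rewrite -!mevalM -mevalB; apply: H; exists v, i, j.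
Qed.

(** * Ping-pong on the line x_1 = x_2 *)

Definition letter_inv n (l : letter n) : letter n :=
  if l is Some (i, b) then Some (i, ~~ b) else None.

(** As [None] is its own inverse, two adjacent involutions are excluded too. *)
Definition reduced n (w : seq (letter n)) : bool :=
  sorted (fun l l' => l' != letter_inv l) w.

Section PingPong.
Variables (F : realFieldType) (n : nat).

(* The line x_1 = x_2, with affine coordinate y = x_1 / x_0, is preserved by
   the Cremona involution, which acts on it as y |-> 1 / y. *)
Definition line_vec (y : F) : 'cV[F]_3 := \col_i (if i == 0 then 1 else y).

(** Small enough that [2n] discs with centers [4 * radius] apart fit into the interval from 0 to
    1/2. *)
Definition radius : F := (64 * n%:R + 32)^-1.

(** The [2n] pairs are numbered from 1, which keeps the first disc away from 0. The disc of [(i, b)]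
    receives the images under that letter and that of [(i, ~~ b)] surrounds its pole. *)
Definition center (a : 'I_n * bool) : F := 4 * (a.1.*2 + a.2).+1%:R * radius.

(* Acts on the line as y |-> c + r^2 / (y - d). *)
Definition schottky_mx (r c d : F) : 'M[F]_3 :=
  \matrix_(i, j) nth 0 (nth [::] [:: [:: - d; 1; 0];
    [:: r ^+ 2 - c * d; c; 0]; [:: r ^+ 2 - c * d; c - r; r]] i) j.

Definition schottky (i : 'I_n) : 'M[F]_3 :=
  schottky_mx radius (center (i, false)) (center (i, true)).

(** The last two rows agree on vectors [(1, y, y)], so the line is preserved; the first row gives
    the denominator [y - d]. *)
Lemma schottky_line (r c d y : F) : y != d ->
  schottky_mx r c d *m line_vec y = (y - d) *: line_vec (c + r ^+ 2 / (y - d)).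
Proof.
move=> nyd; have nz : y - d != 0 by rewrite subr_eq0.
apply/colP => i; rewrite !mxE !big_ord_recl big_ord0 !mxE /=.
by case: i => [[|[|[|//]]] lti] /=; field.
Qed.

(** Solving [z = c + r^2 / (y - d)] for [y] exchanges [c] and [d]. The corner entry [r] makes this
    an identity of matrices, off the line as well. *)
Lemma schottky_mxV (r c d : F) :
  schottky_mx r c d *m schottky_mx r d c = (r ^+ 2)%:M.
Proof.
apply/matrixP => i j; rewrite !mxE !big_ord_recl big_ord0 !mxE /=.
by case: i => [[|[|[|//]]] lti]; case: j => [[|[|[|//]]] ltj] /=; rewrite ?mulr1n ?mulr0n; ring.
Qed.

Lemma schottky_unitmx (r c d : F) : r != 0 -> schottky_mx r c d \in unitmx.
Proof.
move=> nzr; have nzr2 : r ^+ 2 != 0 by rewrite expf_neq0.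
have /mulmx1_unit[] // : schottky_mx r c d *m (r ^- 2 *: schottky_mx r d c) = 1%:M.
by rewrite -scalemxAr schottky_mxV -scalemx1 scalerA mulVf ?scale1r.
Qed.

Lemma adj_schottky_line (r c d y : F) : r != 0 -> y != c ->
  exists2 k, k != 0 &
    \adj (schottky_mx r c d) *m line_vec y = k *: line_vec (d + r ^+ 2 / (y - c)).
Proof.
move=> nzr nyc; have nzr2 : r ^+ 2 != 0 by rewrite expf_neq0.
have nz : y - c != 0 by rewrite subr_eq0.
have nzD : \det (schottky_mx r c d) != 0.
  by rewrite -unitfE -unitmxE schottky_unitmx.
(* By [schottky_mxV] the adjugate is [\det / r^2] times [schottky_mx r d c], which contributes the
   factor [y - c]. *)
exists (\det (schottky_mx r c d) * (y - c) / r ^+ 2).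
  by rewrite !mulf_neq0 ?invr_eq0.
apply: (scalerI nzr2); rewrite scalerA mulrC divfK // scalemxAr.
rewrite -(scalerA (\det _)) -schottky_line // -mul_scalar_mx -(schottky_mxV r c d).
by rewrite !mulmxA mul_adj_mx mul_scalar_mx !scalemxAl.
Qed.

Lemma radius_gt0 : 0 < radius.
Proof. by rewrite invr_gt0; have := ler0n F n; lra. Qed.

Lemma radius_le : radius <= 1 / 32.
Proof.
rewrite /radius mul1r lef_pV2 ?posrE; by have := ler0n F n; lra.
Qed.

Lemma center_ge a : 4 * radius <= center a.
Proof.
have r0 := radius_gt0; rewrite /center ler_pM2r // -[leLHS]mulr1 ler_pM2l ?ltr0n //.
by rewrite ler1n.
Qed.

Lemma center_le a : center a <= 1 / 4.
Proof.
have d0 : 0 < 64 * n%:R + 32 :> F by have := ler0n F n; lra.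
rewrite /center /radius ler_pdivrMr //.
have : ((a.1.*2 + a.2).+1)%:R <= (n.*2)%:R :> F.
  rewrite ler_nat; case: a => i b /=; rewrite (leq_trans _ (_ : i.+1.*2 <= n.*2)%N) ?leq_double //.
  by rewrite doubleS !ltnS; case: b; rewrite ?addn1 ?addn0.
by rewrite -(muln2 n) natrM; have := ler0n F n; lra.
Qed.

(** The number of a pair determines it: parity gives the boolean, half gives the index. Distinct
    numbers differ by at least 1. *)
Lemma center_dist a a' : a != a' -> 4 * radius <= `|center a - center a'|.
Proof.
pose k (a : 'I_n * bool) := (a.1.*2 + a.2)%N => naa.
have r0 := radius_gt0.
have nk : k a != k a'.
  apply: contra_neq naa; rewrite /k; case: a a' => i b [j c] /= E.
  have Eb : b = c by have := congr1 odd E; rewrite !oddD !odd_double !oddb.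
  by move: E; rewrite Eb => /addIn/double_inj/val_inj->.
rewrite /center -mulrBl normrM (gtr0_norm r0) ler_pM2r // -mulrBr normrM.
rewrite ger0_norm ?ler0n // -[leLHS]mulr1 ler_pM2l ?ltr0n //.
rewrite -!natr1 opprD addrACA subrr addr0 -/(k a) -/(k a').
case: (ltngtP (k a) (k a')) nk => // lk _.
  by rewrite distrC ger0_norm ?subr_ge0 ?ler_nat 1?ltnW // -natrB 1?ltnW // ler1n subn_gt0.
by rewrite ger0_norm ?subr_ge0 ?ler_nat 1?ltnW // -natrB 1?ltnW // ler1n subn_gt0.
Qed.

(* [3/4] lies outside all of these regions. *)
Definition region (l : letter n) (y : F) : Prop :=
  if l is Some a then `|y - center a| <= radius else 1 < y.

(** Points that the letter is sure to send into its region: those outside the disc around its pole,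
    or the open unit interval for the involution. *)
Definition admissible (l : letter n) (y : F) : Prop :=
  if l is Some (i, b) then radius <= `|y - center (i, ~~ b)| else 0 < y < 1.

(** The combinatorial half of ping-pong: distinct discs are disjoint, all of them lie in the open
    unit interval, and points above 1 are far from every disc. *)
Lemma region_admissible l l' y :
  l' != letter_inv l -> region l' y -> admissible l y.
Proof.
have r0 := radius_gt0; have r1 := radius_le.
case: l => [[i b]|]; case: l' => [a|] //= nl.
- rewrite -[_ == _]/(a == (i, ~~ b)) in nl.
  have := center_dist nl; have := ler_distD y (center a) (center (i, ~~ b)).
  by rewrite (distrC (center a) y); lra.
- have := center_le (i, ~~ b) => c1 y1; rewrite ger0_norm; lra.
- by have := center_le a; have := center_ge a; rewrite ler_norml; lra.
Qed.

(** The dynamical half: distance at least [r] from the pole makes [r^2 / (y - d)] at most [r] in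
    absolute value, and inversion sends the open unit interval above 1. *)
Lemma letter_act_line l k y : k != 0 -> admissible l y ->
  exists k' y', [/\ k' != 0, region l y' &
    letter_act schottky l (k *: line_vec y) = k' *: line_vec y'].
Proof.
have r0 := radius_gt0; have nzr := lt0r_neq0 r0.
case: l => [[i b]|] nzk /= ady; last first.
  have y0 : y != 0 by apply: lt0r_neq0; lra.
  (* The involution sends [k (1, y, y)] to [k^2 (y^2, y, y)]. *)
  exists (k ^+ 2 * y ^+ 2), y^-1; split; first by rewrite !mulf_neq0 ?expf_neq0.
    by rewrite invf_gt1; lra.
  by apply/colP => j; rewrite !mxE; case: j => [[|[|[|//]]] lti] /=; field.
have nyc : y - center (i, ~~ b) != 0 by rewrite -normr_gt0 (lt_le_trans r0).
have regionP : `|center (i, b) + radius ^+ 2 / (y - center (i, ~~ b)) - center (i, b)| <= radius.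
  rewrite addrC addKr normrM normfV ler_pdivrMr ?normr_gt0 //.
  by rewrite (ger0_norm (exprn_ge0 _ (ltW r0))) expr2 ler_pM2l.
rewrite subr_eq0 in nyc; rewrite -scalemxAr /letter_mx.
case: b nyc ady regionP => /= nyc ady regionP.
  have [k' nzk' ->] := adj_schottky_line (center (i, true)) nzr nyc.
  exists (k * k'), (center (i, true) + radius ^+ 2 / (y - center (i, false))).
  by rewrite mulf_neq0 // scalerA.
rewrite schottky_line // scalerA.
by eexists _, _; split; last reflexivity; rewrite ?mulf_neq0 ?subr_eq0.
Qed.

(** The base point 3/4 is admissible for every letter; after that, reducedness makes each region
    admissible for the next letter applied. *)
Lemma word_act_line l w : reduced (l :: w) ->
  exists k y, [/\ k != 0, region l y &
    word_act schottky (l :: w) (line_vec (3 / 4)) = k *: line_vec y].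
Proof.
have r0 := radius_gt0; have r1 := radius_le.
elim: w l => [|l' w IHw] l; rewrite /reduced /=.
  move=> _; rewrite -[line_vec _]scale1r; apply: letter_act_line; first exact: oner_neq0.
  case: l => [[i b]|] /=; last lra.
  by have := center_le (i, ~~ b) => c1; rewrite ger0_norm; lra.
move=> /andP[nl /IHw[k [y [nzk reg E]]]]; rewrite -/(word_act _ (l' :: w) _) /= in E *.
rewrite E; apply: letter_act_line => //; exact: region_admissible reg.
Qed.

Lemma word_act_schottky w : reduced w -> w != [::] ->
  let v := word_act schottky w (line_vec (3 / 4)) in
  v 1 0 * line_vec (3 / 4) 0 0 != v 0 0 * line_vec (3 / 4) 1 0.
Proof.
case: w => [//|l w] rw _; set v := word_act _ _ _ => /=.
have [k [y [nzk reg E]]] := word_act_line rw.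
have r0 := radius_gt0; have r1 := radius_le.
rewrite /v E !mxE /= !mulr1 (inj_eq (mulfI nzk)).
case: l reg {E rw v} => [a|] /= reg; last by rewrite gt_eqF; lra.
have := center_le a; move: reg; rewrite ler_norml => reg c1.
by rewrite lt_eqF; lra.
Qed.

End PingPong.

(** * Homomorphisms from the free products *)

(** Preservation of 1, which [group_hom] bundles, follows by cancellation. *)
Lemma hom_of_morph (G H : groupType) (f : G -> H) :
  {morph f : x y / (x * y)%g} -> exists phi : group_hom G H, phi =1 f.
Proof.
move=> fM; have f1 : f 1%g = 1%g.
  by apply: (mulgI (f 1%g)); rewrite -fM !mulg1.
pose fM' := isMultiplicative.Build G H f fM.
pose f1' := Multiplicative_isUMagmaMorphism.Build G H f f1.
pose phi : group_hom G H := HB.pack f fM' f1'.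
by exists phi.
Qed.

Definition expgz (H : groupType) (h : H) (z : int) : H :=
  match z with Posz k => (h ^+ k)%g | Negz k => (h ^- k.+1)%g end.

Lemma expgz_add1 (H : groupType) (h : H) (z : int) :
  expgz h (1 + z) = (h * expgz h z)%g.
Proof.
case: z => [k|[|k]]; first by rewrite -[1 + _]/(Posz k.+1) /= expgS.
  by rewrite /= expg1 mulgV.
rewrite (_ : 1 + _ = Negz k); last by rewrite !NegzE [in LHS]intS opprD addrA subrr add0r.
by rewrite /= [in RHS]expgSr invgM mulVKg.
Qed.

Lemma expgzD (H : groupType) (h : H) (y z : int) :
  expgz h (y + z) = (expgz h y * expgz h z)%g.
Proof.
elim: y => [|k IHk|k IHk]; first by rewrite add0r mul1g.
  by rewrite intS -addrA !expgz_add1 IHk mulgA.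
apply: (mulgI h); rewrite mulgA -!expgz_add1.
by rewrite intS opprD !addrA subrr add0r IHk.
Qed.

Lemma Zgroup_hom (H : groupType) (h : H) :
  exists phi : group_hom Zgroup H, phi (1%R : int) = h.
Proof.
have [phi E] := hom_of_morph (G := Zgroup) (expgzD h).
by exists phi; rewrite E /= expg1.
Qed.

Lemma Z2group_hom (H : groupType) (h : H) : (h * h = 1)%g ->
  exists phi : group_hom Z2group H, phi (1%R : 'Z_2) = h.
Proof.
move=> hh; pose f (x : Z2group) : H := (h ^+ (x : 'Z_2))%g.
have [phi E] : exists phi : group_hom Z2group H, phi =1 f; last first.
  by exists phi; rewrite E /f expg1.
apply: hom_of_morph => x y; rewrite /f.
by case: x => [[|[|//]] ?]; case: y => [[|[|//]] ?];
  rewrite /= ?expg0 ?expg1 ?mul1g ?mulg1 ?hh.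
Qed.

Lemma Zgroup_hom_mem (H : groupType) (S : {pred H}) (f : group_hom Zgroup H) (z : int) :
  group_closed S -> f (1%R : int) \in S -> f z \in S.
Proof.
move=> cS f1S; have SM := group_closedM cS; have SV := group_closedV cS.
elim: z => [|k IHk|k IHk]; first by have := @gmulf1 _ _ f => ->; case: cS.
  rewrite intS; have := @gmulfM _ _ f (1%R : int) (k : int) => ->; exact: SM.
rewrite intS opprD; have := @gmulfM _ _ f (- 1%R : int) (- (k : int)) => ->.
apply: SM => //; have := gmulfV f (1%R : int) => ->; exact: SV.
Qed.

Section FreeProductMem.
Context {I : choiceType} (G : I -> groupType).

Lemma fp_inj_hom i : exists f : group_hom (G i) (free_product G), f =1 @fp_inj _ G i.
Proof. by apply: hom_of_morph; exact: fp_injM. Qed.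

Lemma free_product_mem (S : {pred free_product G}) :
  group_closed S -> (forall i (x : G i), fp_inj x \in S) -> forall g, g \in S.
Proof.
move=> cS SG; elim/quotW => u; rewrite -[\pi u]/(fp_class u) fp_class_prod.
elim: u => [|[i x] u IHu]; first by rewrite big_nil; case: cS.
by rewrite big_cons; apply: (group_closedM cS) => //; exact: SG.
Qed.

End FreeProductMem.

Lemma hom_preim_closed (G H : groupType) (f : group_hom G H) (S : {pred H}) :
  group_closed S -> group_closed [pred g | f g \in S].
Proof.
move=> [S1 SF]; split; first by rewrite inE gmulf1.
by move=> u v; rewrite !inE gmulfF; exact: SF.
Qed.

Lemma generated_image (G H : groupType) (f : group_hom G H) (X : H -> Prop) h :
  (forall k, X k -> exists g, f g = k) -> generated X h -> exists g, f g = h.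
Proof.
(* [generated] ranges over boolean predicates, so the image, a subgroup containing [X], is made
   boolean classically. *)
move=> Xf gen; apply/asboolP; apply: (gen (fun h => `[< exists g, f g = h >])).
  split; first by apply/asboolP; exists 1%g; rewrite gmulf1.
  move=> _ _ /asboolP[u <-] /asboolP[v <-]; apply/asboolP.
  by exists (u / v)%g; rewrite gmulfF.
by move=> k /Xf ?; apply/asboolP.
Qed.

Section Free.
Variable n : nat.

Lemma freeZ_Z2_mem (S : {pred freeZ_Z2 n}) : group_closed S ->
  (forall i, freeZ_Z2_gen i \in S) -> freeZ_Z2_inv n \in S -> forall g, g \in S.
Proof.
move=> cS Sg Si; apply: free_product_mem => // -[i|] x.
  have [f fE] := fp_inj_hom (@free_factor n) (Some i); rewrite -fE.
  by apply: Zgroup_hom_mem => //; rewrite fE; exact: Sg.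
have [f fE] := fp_inj_hom (@free_factor n) None; rewrite -fE.
have [x0|x1] : x = (0%R : 'Z_2) \/ x = (1%R : 'Z_2).
- by case: x => [[|[|//]] ?]; [left|right]; apply: val_inj.
- by rewrite x0; have := @gmulf1 _ _ f => ->; case: cS.
- by rewrite x1 fE; exact: Si.
Qed.

Lemma free_group_mem (S : {pred free_group n}) : group_closed S ->
  (forall i, free_gen i \in S) -> forall g, g \in S.
Proof.
move=> cS Sg; apply: free_product_mem => // i x.
have [f fE] := fp_inj_hom (fun _ : 'I_n => Zgroup) i; rewrite -fE.
by apply: Zgroup_hom_mem => //; rewrite fE; exact: Sg.
Qed.

Lemma freeZ_Z2_hom (H : groupType) (a : 'I_n -> H) (s : H) : (s * s = 1)%g ->
  exists phi : group_hom (freeZ_Z2 n) H,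
    (forall i, phi (freeZ_Z2_gen i) = a i) /\ phi (freeZ_Z2_inv n) = s.
Proof.
move=> ss.
have [fs fsE] := Z2group_hom ss.
pose f o : group_hom (@free_factor n o) H :=
  match o with Some i => sval (cid (Zgroup_hom (a i))) | None => fs end.
have [phi phiE _] := fp_universal f; exists phi; split=> [i|].
  by rewrite [LHS]phiE /=; case: cid.
by rewrite [LHS]phiE.
Qed.

Lemma free_group_hom (H : groupType) (a : 'I_n -> H) :
  exists phi : group_hom (free_group n) H, forall i, phi (free_gen i) = a i.
Proof.
pose f i : group_hom Zgroup H := sval (cid (Zgroup_hom (a i))).
have [phi phiE _] := fp_universal f; exists phi => i.
by rewrite [LHS]phiE /f; case: cid.
Qed.

End Free.

(** * Reduced words in the free product *)

Section WordVal.
Variable n : nat.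
Implicit Types w : seq (letter n).

Lemma letter_val_inv (G : groupType) (a : 'I_n -> G) (s : G) l :
  (s * s = 1)%g -> letter_val a s (letter_inv l) = (letter_val a s l)^-1%g.
Proof.
move=> ss; case: l => [[i []]|] /=; rewrite ?invgK //.
by apply: (mulgI s); rewrite ss mulgV.
Qed.

Lemma word_val_inv (G : groupType) (a : 'I_n -> G) (s : G) w : (s * s = 1)%g ->
  word_val a s (rev (map (@letter_inv n) w)) = (word_val a s w)^-1%g.
Proof.
move=> ss; elim: w => [|l w IHw]; first by rewrite !word_val_nil invg1.
rewrite map_cons rev_cons -cats1 word_val_cat !word_val_cons word_val_nil mulg1.
by rewrite invgM IHw letter_val_inv.
Qed.

(** A letter put before a reduced word either keeps it reduced or cancels its head, leaving a
    reduced tail. *)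
Lemma reduce_word w : exists2 w', reduced w' &
  forall (G : groupType) (a : 'I_n -> G) (s : G), (s * s = 1)%g ->
    word_val a s w = word_val a s w'.
Proof.
elim: w => [|l w [w' rw' Ew]]; first by exists [::].
case: w' rw' Ew => [|l' w'] rw' Ew.
  by exists [:: l] => // G a s ss; rewrite !word_val_cons Ew.
have [El|nl] := eqVneq l' (letter_inv l); last first.
  exists [:: l, l' & w']; first by rewrite /reduced /= nl.
  by move=> G a s ss; rewrite 2!word_val_cons Ew // -!word_val_cons.
exists w'; first exact: path_sorted rw'.
move=> G a s ss; rewrite word_val_cons Ew // word_val_cons El.
by rewrite letter_val_inv // mulgA mulgV mul1g.
Qed.

Lemma hom_word_val (G H : groupType) (f : group_hom G H) (a : 'I_n -> G) (s : G) w :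
  f (word_val a s w) = word_val (fun i => f (a i)) (f s) w.
Proof.
rewrite /word_val gmulf_prod; apply: eq_bigr => -[[i []]|] _ //=.
by rewrite gmulfV.
Qed.

Lemma freeZ_Z2_invM : (freeZ_Z2_inv n * freeZ_Z2_inv n = 1)%g.
Proof.
rewrite /freeZ_Z2_inv -fp_injM; have [f fE] := fp_inj_hom (@free_factor n) None.
rewrite -fE -(@gmulf1 _ _ f); congr (f _); exact: val_inj.
Qed.

(** Values of words form a subgroup containing the generators. Uniqueness of the word is not
    claimed: ping-pong replaces it. *)
Lemma freeZ_Z2_word (g : freeZ_Z2 n) :
  exists2 w, reduced w & g = word_val (@freeZ_Z2_gen n) (freeZ_Z2_inv n) w.
Proof.
suff [w Ew] : exists w, g = word_val (@freeZ_Z2_gen n) (freeZ_Z2_inv n) w.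
  have [w' rw' E] := reduce_word w; exists w' => //.
  by rewrite Ew E // freeZ_Z2_invM.
apply/asboolP; move: g.
apply: (freeZ_Z2_mem (S := fun g => `[< exists w, g = word_val _ _ w >])).
- split; first by apply/asboolP; exists [::]; rewrite word_val_nil.
  move=> _ _ /asboolP[u ->] /asboolP[v ->]; apply/asboolP.
  exists (u ++ rev (map (@letter_inv n) v)).
  by rewrite word_val_cat word_val_inv // freeZ_Z2_invM.
- by move=> i; apply/asboolP; exists [:: Some (i, false)]; rewrite word_val_cons word_val_nil mulg1.
- by apply/asboolP; exists [:: None]; rewrite word_val_cons word_val_nil mulg1.
Qed.

Lemma freeZ_Z2_hom_inj (H : groupType) (phi : group_hom (freeZ_Z2 n) H)
    (a : 'I_n -> H) (s : H) :
  (forall i, phi (freeZ_Z2_gen i) = a i) -> phi (freeZ_Z2_inv n) = s ->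
  (forall w, reduced w -> w != [::] -> word_val a s w <> 1%g) -> injective phi.
Proof.
move=> phia phis nt; apply: gmulf_inj => g; have [w rw ->] := freeZ_Z2_word g.
rewrite hom_word_val phis (funext phia : (fun i => _) = a) => w1.
have [->|nw] := eqVneq w [::]; first by rewrite word_val_nil.
by case: (nt w rw nw).
Qed.

Lemma freeZ_Z2_image (H : groupType) (phi : group_hom (freeZ_Z2 n) H) (X : H -> Prop) :
  (forall h, X h <-> (exists i, h = phi (freeZ_Z2_gen i)) \/ h = phi (freeZ_Z2_inv n)) ->
  forall h, generated X h <-> exists g, phi g = h.
Proof.
move=> XE h; split=> [gen|[g <-] S cS SX].
  by apply: generated_image gen => k /XE[[i ->]|->]; eexists.
apply: (freeZ_Z2_mem (hom_preim_closed phi cS)) => [i|]; apply: SX; apply/XE.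
  by left; exists i.
by right.
Qed.

Lemma free_group_image (H : groupType) (psi : group_hom (free_group n) H) (X : H -> Prop) :
  (forall h, X h <-> exists i, h = psi (free_gen i)) ->
  forall h, generated X h <-> exists g, psi g = h.
Proof.
move=> XE h; split=> [gen|[g <-] S cS SX].
  by apply: generated_image gen => k /XE[i ->]; eexists.
by apply: (free_group_mem (hom_preim_closed psi cS)) => i; apply: SX; apply/XE; exists i.
Qed.

(* Killing the involution and sending each generator of infinite order to the
   corresponding free generator is a left inverse. *)
Lemma free_group_into_freeZ_Z2 :
  exists2 iota : group_hom (free_group n) (freeZ_Z2 n),
    forall i, iota (free_gen i) = (freeZ_Z2_gen i * freeZ_Z2_inv n)%g & injective iota.
Proof.
have [iota iotaE] := free_group_hom (fun i => freeZ_Z2_gen i * freeZ_Z2_inv n)%g.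
have [rho [rhog rhoi]] := freeZ_Z2_hom (@free_gen n) (mul1g 1%g).
exists iota => //; apply: (can_inj (g := rho)) => g.
apply/eqP; move: g.
apply: (free_group_mem (S := fun g => rho (iota g) == g)) => [|i].
  split; first by rewrite unfold_in !gmulf1.
  by move=> u v /eqP Eu /eqP Ev; rewrite unfold_in !gmulfF Eu Ev.
by rewrite unfold_in iotaE gmulfM rhog rhoi mulg1.
Qed.

End WordVal.

(** * Generic tuples *)

(** The witness is the real Schottky tuple; injectivity of [real_complex] carries the inequality at
    the base point over to the complex numbers. *)
Lemma word_val_nontrivial (R : rcfType) n (w : seq (letter n)) :
  reduced w -> w != [::] -> exists A : 'I_n -> PGL3 R[i],
    word_val (fun i => pgl_bir (A i)) (cremona R[i]) w <> 1%g.
Proof.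
move=> rw nw.
have uM (i : 'I_n) : map_mx (real_complex R) (schottky R i) \in unitmx.
  by rewrite map_unitmx schottky_unitmx // lt0r_neq0 // radius_gt0.
exists (fun i => pgl_class (Sub (map_mx (real_complex R) (schottky R i)) (uM i))).
move/word_val_bir1/(_ (map_mx (real_complex R) (line_vec (3 / 4))) 1 0).
have := word_act_schottky R rw nw; set v := word_act _ _ _ => /= /negP nv.
rewrite -(map_word_act _ _ w (line_vec _)) -/v !mxE -!rmorphM.
by move/fmorph_inj=> E; apply: nv; move: E; rewrite !mxE => ->.
Qed.

Lemma cremonaM (K : fieldType) : (cremona K * cremona K = 1)%g.
Proof.
rewrite bir_ofM -[RHS]/(bir_of (@id_birational K)); apply/bir_of_same.
by rewrite comp_cremona; apply/same_mapP => i j; rewrite !tnth_mktuple mulrAC.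
Qed.

Definition nontrivial_word n (k : nat) : seq (letter n) :=
  if unpickle k is Some w then
    if reduced w && (w != [::]) then w else [:: None]
  else [:: None].

Lemma nontrivial_wordP n k :
  reduced (nontrivial_word n k) && (nontrivial_word n k != [::]).
Proof. by rewrite /nontrivial_word; case: unpickle => // w; case: ifP. Qed.

Lemma nontrivial_word_surj n (w : seq (letter n)) : reduced w -> w != [::] ->
  nontrivial_word n (pickle w) = w.
Proof. by move=> rw nw; rewrite /nontrivial_word pickleK rw nw. Qed.

Theorem proposition5p9 (R : realType) (n : nat) :
  holds_generically (fun A : 'I_n -> PGL3 R[i] =>
    (exists phi : group_hom (freeZ_Z2 n) (Bir R[i]),
       [/\ isom_onto phi
             (generated (fun g => (exists i, g = pgl_bir (A i))
                                  \/ g = cremona R[i])),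
           forall i, phi (freeZ_Z2_gen i) = pgl_bir (A i)
         & phi (freeZ_Z2_inv n) = cremona R[i]])
    /\
    (exists psi : group_hom (free_group n) (Bir R[i]),
       isom_onto psi
         (generated (fun g => exists i, g = (pgl_bir (A i) * cremona R[i])%g))
       /\ forall i, psi (free_gen i) = (pgl_bir (A i) * cremona R[i])%g)).
Proof.
exists (fun k A => word_val (fun i => pgl_bir (A i)) (cremona R[i])
                     (nontrivial_word n k) = 1%g).
split=> [k|A nt].
  have /andP[rw nw] := nontrivial_wordP n k.
  by split; [exact: word_val_closed | exact: word_val_nontrivial].
have [phi [phig phii]] := freeZ_Z2_hom (fun i => pgl_bir (A i)) (cremonaM R[i]).
have phi_inj : injective phi.
  apply: (freeZ_Z2_hom_inj phig phii) => w rw nw.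
  by rewrite -(nontrivial_word_surj rw nw); exact: nt.
split.
  exists phi; split=> //; split=> //; apply: freeZ_Z2_image => h; rewrite phii.
  by split=> -[[i ->]|->]; [left; exists i | right | left; exists i | right].
(* Freeness of the quadratic maps is inherited from the free product through this embedding. *)
have [iota iotaE iota_inj] := free_group_into_freeZ_Z2 n.
have psiE i : phi (iota (free_gen i)) = (pgl_bir (A i) * cremona R[i])%g.
  by rewrite iotaE gmulfM phig phii.
exists (phi \o iota : group_hom _ _); split=> [|i]; last exact: psiE.
split; first exact: inj_comp.
by apply: free_group_image => h; split=> -[i ->]; exists i; rewrite -?psiE.
Qed.
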